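(* Let $G=(V,E)$ be a finite graph without loops (multiple edges are allowed). Let $q\in\{2,3,\dots\}$, let $\beta\in(0,\infty)$, let $\mathbf{J}=(J_e:e\in E)$ be a vector of non-negative real numbers, and set $\lambda_e=\beta J_e$ for $e\in E$ and $\boldsymbol{\lambda}=(\lambda_e:e\in E)$. Then, for all $x,y\in V$ with $x\neq y$, $$ \sigma(x,y)=\frac{\mathbb{E}_{\boldsymbol{\lambda}}\bigl(C(G_{\mathbf{P}}^{x,y};q)\bigr)}{\mathbb{E}_{\boldsymbol{\lambda}}\bigl(C(G_{\mathbf{P}};q)\bigr)}, $$ where $\sigma(x,y)$ is $q$ times the two-point correlation function of the $q$-state Potts model on $G$ with parameters $\beta\mathbf{J}$, $C(H;q)$ is the number of non-zero mod-$q$ flows on a graph $H$, $G_{\mathbf{P}}$ is the Poisson graph derived from $G$ with intensity $\boldsymbol{\lambda}$, and $G_{\mathbf{P}}^{x,y}$ is $G_{\mathbf{P}}$ with one extra edge joining $x$ and $y$.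
   Context: Potts model. The configuration space is $\Sigma=\{1,2,\dots,q\}^V$. For $\sigma\in\Sigma$ and an edge $e=\langle x,y\rangle\in E$, let $\delta_e(\sigma)=\delta_{\sigma_x,\sigma_y}$, equal to $1$ if $\sigma_x=\sigma_y$ and $0$ otherwise. The Potts measure on $\Sigma$ is $$ \pi_{\beta\mathbf{J},q}(\sigma)=\frac{1}{Z}\exp\Bigl\{\sum_{e\in E}\beta J_e(q\delta_e(\sigma)-1)\Bigr\},\qquad Z=\sum_{\sigma\in\Sigma}\exp\Bigl\{\sum_{e\in E}\beta J_e(q\delta_e(\sigma)-1)\Bigr\}. $$ The two-point correlation function is $\tau_{\beta\mathbf{J},q}(x,y)=\pi_{\beta\mathbf{J},q}(\sigma_x=\sigma_y)-\frac1q$ for $x,y\in V$, and $\sigma(x,y)=q\,\tau_{\beta\mathbf{J},q}(x,y)$, which equals the mean of $q\delta_{\sigma_x,\sigma_y}-1$ under $\pi_{\beta\mathbf{J},q}$. Flows. Let $H=(W,F)$ be a finite graph, possibly with multiple edges. Allocate an arbitrary orientation to each edge, giving a digraph $\vec H=(W,\vec F)$. A function $f:\vec F\to\{0,1,\dots,q-1\}$ is a mod-$q$ flow if, for every $v\in W$, the sum of $f(\vec e)$ over edges $\vec e$ leaving $v$ minus the sum of $f(\vec e)$ over edges $\vec e$ arriving at $v$ equals $0$ modulo $q$. It is non-zero if $f(\vec e)\neq 0$ for every $\vec e\in\vec F$. $C(H;q)$ denotes the number of non-zero mod-$q$ flows on $\vec H$; it is a standard fact that this number does not depend on the choice of orientations.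 (If $F=\varnothing$ then $C(H;q)=1$.) Poisson graph. For a vector $\mathbf{m}=(m(e):e\in E)$ of non-negative integers, $G_{\mathbf{m}}=(V,E_{\mathbf{m}})$ is the graph with vertex set $V$ in which each edge $e\in E$ is removed and replaced by exactly $m(e)$ parallel edges joining the endvertices of $e$. Let $\mathbf{P}=(P(e):e\in E)$ be independent random variables such that $P(e)$ has the Poisson distribution with parameter $\lambda_e$ (with $P(e)=0$ almost surely if $\lambda_e=0$). The random graph $G_{\mathbf{P}}$ is the Poisson graph with intensity $\boldsymbol{\lambda}$, and $\mathbb{E}_{\boldsymbol{\lambda}}$ is the corresponding expectation. For $x\ne y$, $G_{\mathbf{P}}^{x,y}$ is obtained from $G_{\mathbf{P}}$ by adding exactly one further edge with endvertices $x,y$ (whether or not $x$ and $y$ are already adjacent). *)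

(* Defs.v *)
From HB Require Import structures.
From mathcomp Require Import all_boot all_order all_algebra.
From mathcomp Require Import all_classical all_reals all_analysis.

Set Implicit Arguments.
Unset Strict Implicit.
Unset Printing Implicit Defensive.

Import Order.TTheory GRing.Theory Num.Theory.

Local Open Scope ring_scope.

(* Finite undirected multigraphs on the vertex set V: loops and parallel edges
   are allowed, and the order inside the pair [ends e] has no meaning. *)
Record mgraph (V : finType) := MGraph {
  edge : finType;
  ends : edge -> V * V }.

Definition loopless (V : finType) (G : mgraph V) : Prop :=
  forall e : edge G, (ends e).1 != (ends e).2.

Section Flows.
Variables (V : finType) (H : mgraph V) (q : nat).

(* [o e] tells whether e is oriented against the order of the pair [ends e]. *)
Definition orientation := {ffun edge H -> bool}.
Implicit Types (o : orientation) (f : {ffun edge H -> 'I_q}).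

Definition tail o (e : edge H) : V := if o e then (ends e).2 else (ends e).1.
Definition head o (e : edge H) : V := if o e then (ends e).1 else (ends e).2.

Definition is_flow o f : bool :=
  [forall v : V, (q%:Z %| (\sum_(e | tail o e == v) (f e : nat)%:Z)
                          - \sum_(e | head o e == v) (f e : nat)%:Z)%Z].

Definition nonzero_flow o f : bool :=
  is_flow o f && [forall e, (f e : nat) != 0%N].

Definition nflows_oriented o : nat := #|[pred f | nonzero_flow o f]|.

Definition nflows : nat := nflows_oriented [ffun => false].

Let neg (k : 'I_q) : 'I_q :=
  Ordinal (ltn_pmod (q - k) (leq_ltn_trans (leq0n k) (ltn_ord k))).

Let neg_val (k : 'I_q) :
  neg k = (if (k : nat) == 0 then 0 else q - k)%N :> nat.
Proof.
have kq := ltn_ord k; rewrite /=.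
case: eqP => [->|/eqP k0]; first by rewrite subn0 modnn.
by rewrite modn_small // ltn_subrL lt0n k0 (leq_ltn_trans (leq0n k) kq).
Qed.

Let negK : involutive neg.
Proof.
move=> k; apply: val_inj; apply: etrans (neg_val (neg k)) _; rewrite neg_val.
rewrite [RHS]/=; case: (altP ((k : nat) =P 0%N)) => [-> //|k0].
by rewrite subn_eq0 leqNgt ltn_ord /= subKn // ltnW.
Qed.

Let neg_dvd (k : 'I_q) : (q%:Z %| (neg k : nat)%:Z + (k : nat)%:Z)%Z.
Proof.
rewrite neg_val; case: eqP => [->|_]; first by rewrite addr0 dvdz0.
by rewrite -PoszD subnK ?dvdzz // ltnW.
Qed.

Let reorient o o' f : {ffun edge H -> 'I_q} :=
  [ffun e => if o e == o' e then f e else neg (f e)].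

Let reorient_inj o o' : injective (reorient o o').
Proof.
apply: (can_inj (g := reorient o o')) => f; apply/ffunP => e; rewrite !ffunE.
by case: (o e == o' e); rewrite ?negK.
Qed.

Let reorient_flow o o' f :
  nonzero_flow o f -> nonzero_flow o' (reorient o o' f).
Proof.
case/andP => /forallP fl /forallP nz; apply/andP; split; last first.
  apply/forallP => e; rewrite ffunE; case: ifP => // _.
  by rewrite neg_val (negbTE (nz e)) subn_eq0 -ltnNge.
apply/forallP => v; rewrite -[X in (_ %| X)%Z](subrK
  ((\sum_(e | tail o e == v) (f e : nat)%:Z)
     - \sum_(e | head o e == v) (f e : nat)%:Z)).
apply: rpredD; last exact: fl.
rewrite [X in X - _ - _]big_mkcond [X in _ - X - _]big_mkcond.
rewrite [X in _ - (X - _)]big_mkcond [X in _ - (_ - X)]big_mkcond.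
rewrite -!sumrB; apply: rpred_sum => e _; rewrite ffunE /tail /head.
have /= dv := neg_dvd (f e).
by case: (o e); case: (o' e) => /=;
   case: ifP => _; case: ifP => _;
   rewrite ?subrr ?subr0 ?sub0r ?oppr0 ?opprK ?rpred0 -?opprD ?rpredN.
Qed.

(* The choice of orientation in [nflows] is immaterial. *)
Lemma nflows_orientedE o : nflows_oriented o = nflows.
Proof.
suff le o1 o2 : (nflows_oriented o1 <= nflows_oriented o2)%N.
  by apply/eqP; rewrite eqn_leq !le.
rewrite /nflows_oriented -(fintype.card_image (@reorient_inj o1 o2)).
apply/subset_leq_card/fintype.subsetP => _ /fintype.imageP[f flf ->]; exact: reorient_flow flf.
Qed.

End Flows.

Definition multiply_edges (V : finType) (G : mgraph V) (m : edge G -> nat) :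
    mgraph V :=
  @MGraph V {e : edge G & 'I_(m e)} (fun p => ends (tag p)).

Definition add_edge (V : finType) (G : mgraph V) (x y : V) : mgraph V :=
  @MGraph V (option (edge G)) (fun e => if e is Some e' then ends e' else (x, y)).

(* [K e] is the product of the inverse temperature and the coupling of e. *)
Section Potts.
Variables (R : realType) (V : finType) (G : mgraph V) (q : nat).
Variable K : edge G -> R.

Definition config := {ffun V -> 'I_q}.
Implicit Type s : config.

Definition potts_weight s : R :=
  expR (\sum_(e : edge G)
          K e * (q%:R * (s (ends e).1 == s (ends e).2)%:R - 1)).

Definition potts_Z : R := \sum_(s : config) potts_weight s.

Definition potts s : R := potts_weight s / potts_Z.

Definition two_point (x y : V) : R :=
  (\sum_(s : config | s x == s y) potts s) - q%:R^-1.

Definition potts_sigma (x y : V) : R := q%:R * two_point x y.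

End Potts.

Definition mutually_independent d d' (T : measurableType d)
    (T' : measurableType d') (R : realType) (Pr : probability T R)
    (I : finType) (X : I -> {RV Pr >-> T'}) : Prop :=
  forall (S : {set I}) (A : I -> set T'),
    (forall i, measurable (A i)) ->
    Pr (\bigcap_(i in [set` S]) (X i @^-1` A i))%classic
      = (\prod_(i in S) Pr (X i @^-1` A i)%classic)%E.

(* Main.v *)
Require Import Defs.
From HB Require Import structures.
From mathcomp Require Import all_boot all_order all_algebra all_field.
From mathcomp Require Import all_classical all_reals all_analysis.
From mathcomp Require Import measurable_realfun measurable_fun_approximation.

Set Implicit Arguments.
Unset Strict Implicit.
Unset Printing Implicit Defensive.

Import Order.TTheory GRing.Theory Num.Theory.
Import numFieldNormedType.Exports.

Local Open Scope ring_scope.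

(** Write [t_e(s) = q * delta_e(s) - 1] for a spin configuration [s] and an
    edge [e].  Expanding over the characters of Z/q turns the count of
    non-zero flows of a multigraph [H] into a spin sum
    ([nflows_potts_sum]):

      [q ^ #|V| * C(H; q) = \sum_s \prod_(e in H) t_e(s)].

    For the Poisson graph the product over parallel edges is
    [\prod_e t_e(s) ^ P(e)], and an added edge [xy] contributes the factor
    [q * delta_xy(s) - 1].  The [P(e)] are independent, so the expectation
    factorises over the edges ([expectation_prod]), and the generating
    function of the Poisson law gives
    [E (t_e ^ P(e)) = exp (lambda_e * (t_e - 1))]
    ([expectation_exp_poisson]).  The product of these factors is
    [exp (- \sum_e lambda_e)] times the Potts weight of [s].  Up to the common
    constant [q ^- #|V| * exp (- \sum_e lambda_e)], the denominator is
    therefore the partition function [Z], and the numerator is the sum of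
    [q * delta_xy - 1] against the Potts weights; their ratio is the Potts mean
    of [q * delta_xy - 1], which is [sigma(x, y)].

    The numbers [t_e(s)] take the value -1, so the products are signed.
    Factorisation is first proved for non-negative functions, where
    expectations may be split freely into countable sums over the values of a
    variable; applied to absolute values it yields integrability, after which
    signed functions are reached by linearity. *)

(** * Non-zero flows as spin sums *)

Lemma prim_root_exprz_eq1 (F : fieldType) (q : nat) (z : F) (a : int) :
  q.-primitive_root z -> (z ^ a == 1) = (q%:Z %| a)%Z.
Proof.
move=> zq; case: a => n; first by rewrite -exprnP -(prim_order_dvd zq) dvdzE.
by rewrite NegzE -exprnN invr_eq1 -(prim_order_dvd zq) dvdzE abszN.
Qed.

(** Orthogonality of the characters of Z/q: the sum is geometric. *)
Lemma sum_unity_root (F : fieldType) (q : nat) (w : F) :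
  w ^+ q = 1 -> \sum_(k < q) w ^+ k = (w == 1)%:R * q%:R.
Proof.
move=> wq; case: eqVneq => [->|w1].
  under eq_bigr do rewrite expr1n.
  by rewrite sumr_const card_ord mul1r.
have /eqP := subrX1 w q.
by rewrite wq subrr eq_sym mulf_eq0 subr_eq0 (negbTE w1) mul0r => /eqP.
Qed.

(** Summation by parts on a graph: with [t] the tail (or the head) of an edge,
    this moves a pairing of spins with flow divergence from the vertices to the
    edges. *)
Lemma sum_fibres (I V : finType) (t : I -> V) (a : V -> int) (b : I -> int) :
  \sum_v a v * \sum_(i | t i == v) b i = \sum_i a (t i) * b i.
Proof.
under eq_bigr do rewrite big_distrr /=.
rewrite (exchange_big_dep xpredT) //=; apply: eq_bigr => i _.
by rewrite (big_pred1 (t i)) // => v; rewrite eq_sym.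
Qed.

(** Fourier duality on Z/q.  With [z] a primitive [q]-th root of unity, the
    indicator that [f] is conserved at [v] is the average over spins [k] of
    [z ^ (k * outflow f v)].  Multiplying over the vertices gives a sum over
    spin configurations whose exponent, regrouped by edges, is
    [\sum_e f e * (s (tail e) - s (head e))]; summing each [f e] over the
    non-zero residues leaves [q - 1] when the spins at the ends of [e] agree and
    [-1] otherwise. *)
Lemma nflows_potts_sum (R : numDomainType) (V : finType) (H : mgraph V)
    (q : nat) : (0 < q)%N ->
  (nflows H q)%:R * q%:R ^+ #|V|
    = \sum_(s : {ffun V -> 'I_q}) \prod_(e : edge H)
        (q%:R * (s (ends e).1 == s (ends e).2)%:R - 1) :> R.
Proof.
move=> q0.
(* Both sides are images of integers, so the identity may be checked in the
   algebraic numbers, which contain the root of unity. *)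
suff eqZ : (nflows H q)%:R * q%:R ^+ #|V|
    = \sum_(s : {ffun V -> 'I_q}) \prod_(e : edge H)
        (q%:R * (s (ends e).1 == s (ends e).2)%:R - 1) :> int.
  have /(congr1 (fun n : int => n%:~R : R)) := eqZ.
  rewrite rmorphM rmorphXn rmorph_sum /= !rmorph_nat => ->.
  apply: eq_bigr => s _; rewrite rmorph_prod; apply: eq_bigr => e _.
  by rewrite rmorphB rmorphM /= !rmorph_nat.
apply: (@intr_inj algC).
rewrite rmorphM rmorphXn rmorph_sum /= !rmorph_nat.
have [z zq] := C_prim_root_exists q0.
have z0 : z != 0.
  apply: contra_eq_neq (prim_expr_order zq) => ->.
  by rewrite expr0n gtn_eqF // eq_sym oner_neq0.
pose o : orientation H := [ffun => false].
pose outflow (f : {ffun edge H -> 'I_q}) (v : V) : int :=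
  (\sum_(e | Defs.tail o e == v) (f e : nat)%:Z)
    - \sum_(e | Defs.head o e == v) (f e : nat)%:Z.
pose w (s : {ffun V -> 'I_q}) (e : edge H) : algC :=
  z ^ ((s (Defs.tail o e) : nat)%:Z - (s (Defs.head o e) : nat)%:Z).
have wq s e : w s e ^+ q = 1.
  by rewrite /w exprnP exprzAC -exprnP (prim_expr_order zq) exp1rz.
have w1 s e : (w s e == 1) = (s (ends e).1 == s (ends e).2).
  rewrite (prim_root_exprz_eq1 _ zq) -eqz_mod_dvd !modz_nat.
  by rewrite !modn_small // /Defs.tail /Defs.head ffunE.
have vertex_edge (s : {ffun V -> 'I_q}) f :
    \prod_v (z ^ outflow f v) ^+ s v = \prod_e w s e ^+ f e.
  under eq_bigr do rewrite exprnP exprz_exp mulrC.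
  under [RHS]eq_bigr do rewrite exprnP exprz_exp.
  rewrite -!(big_morph (fun a : int => z ^ a) (fun a b => expfzDr a b z0)
    (expr0z z)).
  congr (z ^ _); rewrite /outflow.
  under eq_bigr do rewrite mulrBr.
  under [RHS]eq_bigr do rewrite mulrBl.
  by rewrite !sumrB !(sum_fibres _ (fun v => (s v : nat)%:Z)).
have flow_ind f :
    \sum_(s : {ffun V -> 'I_q}) \prod_v (z ^ outflow f v) ^+ s v
    = (is_flow o f)%:R * q%:R ^+ #|V|.
  rewrite -(bigA_distr_bigA (fun v (k : 'I_q) => (z ^ outflow f v) ^+ k)).
  under eq_bigr => v _.
    rewrite sum_unity_root; last first.
      by rewrite exprnP exprzAC -exprnP (prim_expr_order zq) exp1rz.
    rewrite (prim_root_exprz_eq1 _ zq); over.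
  rewrite big_split /= prodr_const -natr_prod; congr (_%:R * _).
  case: (boolP (is_flow o f)) => [/forallP fl|/forallPn[v nfl]].
    by rewrite big1 // => v _; rewrite fl.
  by rewrite (bigD1 v) //= (negbTE nfl) mul0n.
transitivity (\sum_(f : {ffun edge H -> 'I_q} | [forall e, (f e : nat) != 0%N])
   \sum_(s : {ffun V -> 'I_q}) \prod_e w s e ^+ f e).
  under eq_bigr => f _.
    under eq_bigr do rewrite -vertex_edge.
    rewrite flow_ind; over.
  rewrite -big_distrl /=; congr (_ * _).
  rewrite /nflows /nflows_oriented -sum1_card natr_sum big_mkcond.
  rewrite [RHS]big_mkcond; apply: eq_bigr => f _; rewrite inE /nonzero_flow.
  by case: is_flow; case: ifP.
rewrite exchange_big /=; apply: eq_bigr => s _.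
rewrite rmorph_prod; under [RHS]eq_bigr => e _.
  rewrite rmorphB rmorphM rmorph1 /= !rmorph_nat -w1 mulrC -sum_unity_root //.
  (* The residue k = 0 accounts for the term 1 that is subtracted. *)
  rewrite (bigD1 (Ordinal q0)) //= expr0 addrAC subrr add0r; over.
rewrite (bigA_distr_big [pred k : 'I_q | k != Ordinal q0]
  (fun e (k : 'I_q) => w s e ^+ k)).
apply: eq_bigl => f; apply/forallP/ffun_onP => nz e; exact: nz.
Qed.

(** * Multiplied and added edges *)

Lemma prod_multiply_edges (R : comPzSemiRingType) (V : finType) (G : mgraph V)
    (m : edge G -> nat) (c : V * V -> R) :
  \prod_(e : edge (multiply_edges m)) c (ends e)
    = \prod_(e : edge G) c (ends e) ^+ m e.
Proof.
under [RHS]eq_bigr => e _ do rewrite -[m e]card_ord -prodr_const.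
by rewrite sig_big_dep.
Qed.

Lemma prod_add_edge (R : comPzSemiRingType) (V : finType) (G : mgraph V)
    (x y : V) (c : V * V -> R) :
  \prod_(e : edge (add_edge G x y)) c (ends e)
    = c (x, y) * \prod_(e : edge G) c (ends e).
Proof.
rewrite (bigD1 (None : edge (add_edge G x y))) //=; congr (_ * _).
rewrite (reindex_omap Some id) /=; last by case.
by apply: eq_bigl => e; rewrite eqxx.
Qed.

(** * Independent integer-valued random variables *)

Lemma normrD_ge0 (R : realDomainType) (x : R) : 0 <= `|x| + x.
Proof. by rewrite -lerBlDl sub0r lerNl ler_normr lexx orbT. Qed.

Section NatRandomVariables.
Context d (T : measurableType d) (R : realType) (Pr : probability T R).
Implicit Types (X : {RV Pr >-> nat}) (h : nat -> R).

Lemma measurable_comp_nat X h : measurable_fun setT (fun w => h (X w)).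
Proof. exact: (measurableT_comp (f := h)). Qed.

Lemma measurable_nat_fibre X (A : set nat) :
  measurable (X @^-1` A)%classic.
Proof. exact: measurable_funPTI. Qed.

(** The fibres of [X] partition the space into countably many pieces on each
    of which [h (X w)] is constant. *)
Lemma ge0_integral_fibres X h (Y : T -> R) : (forall n, 0 <= h n) ->
    (forall w, 0 <= Y w) -> measurable_fun setT Y ->
  (\int[Pr]_w (h (X w) * Y w)%:E
    = \sum_(0 <= n <oo)
        (h n)%:E * \int[Pr]_w (\1_[set n] (X w) * Y w)%:E)%E.
Proof.
move=> h0 Y0 mY.
have cover : (\bigcup_n (X @^-1` [set n]) = setT)%classic.
  by rewrite -subTset => w _; exists (X w).
rewrite -{1}cover ge0_integral_bigcup //; first last.
- exact: trivIset_preimage1.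
- by move=> w _; rewrite lee_fin mulr_ge0.
- rewrite cover; apply/measurable_EFinP/measurable_funM => //.
  exact: measurable_comp_nat.
- by move=> n; exact: measurable_nat_fibre.
apply: eq_eseriesr => n _.
rewrite -ge0_integralZl_EFin //; first last.
- apply/measurable_EFinP/measurable_funM => //; exact: measurable_comp_nat.
- by move=> w _; rewrite lee_fin mulr_ge0.
rewrite [LHS]integral_mkcond; apply: eq_integral => w _.
rewrite patchE -EFinM indicE.
have [Xw|Xw] := pselect (X w = n).
  by rewrite !mem_set //= Xw mul1r.
by rewrite !memNset // mul0r mulr0.
Qed.

Section Independence.
Variables (I : finType) (X : I -> {RV Pr >-> nat}).
Hypothesis indepX : mutually_independent X.
Implicit Type g : I -> nat -> R.

Let integrable_comp g :=
  forall i, Pr.-integrable setT (EFin \o (fun w => g i (X i w))).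

Let measurable_prod_comp g (P : pred I) :
  measurable_fun setT (fun w => \prod_(i | P i) g i (X i w)).
Proof.
rewrite [X in measurable_fun _ X](_ : _ =
    fun w => \prod_(i <- enum P) g i (X i w)).
  by apply: measurable_prod => i _; exact: measurable_comp_nat.
by apply/funext => w; rewrite big_enum.
Qed.

(** For indicator functions the formula is the definition of independence.  The
    functions [g i] are then allowed to be general one index at a time: split
    along the fibres of [X i], so that [g i] gets replaced by the indicator of a
    point, and sum back. *)
Lemma ge0_expectation_prod g : (forall i n, 0 <= g i n) -> integrable_comp g ->
  (\int[Pr]_w (\prod_i g i (X i w))%:E
    = \prod_i \int[Pr]_w (g i (X i w))%:E)%E.
Proof.
move=> g0 ig.
(* The list s holds the indices at which g need not be an indicator. *)
suff ind (s : seq I) : forall g, (forall i n, 0 <= g i n) ->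
    integrable_comp g ->
    (forall i, i \notin s -> exists A : set nat, g i = \1_A) ->
    (\int[Pr]_w (\prod_i g i (X i w))%:E
      = \prod_i \int[Pr]_w (g i (X i w))%:E)%E.
  by apply: (ind (enum I)) => // i; rewrite mem_enum.
elim: s => [{ig g0}g g0 ig gA|i s IHs {ig g0}g g0 ig gA].
  have /choice[A gE] : forall i, exists A : set nat, g i = \1_A.
    by move=> i; exact: gA.
  have -> : (\prod_i \int[Pr]_w (g i (X i w))%:E
      = \prod_(i in [set: I]%SET) Pr (X i @^-1` A i)%classic)%E.
    apply: eq_big => [i|i _]; first by rewrite finset.in_setT.
    rewrite -[X in Pr X]setIT -integral_indic //; last first.
      exact: measurable_nat_fibre.
    by apply: eq_integral => w _; rewrite gE.
  rewrite -indepX // -[X in Pr X]setIT -integral_indic //; last first.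
    apply: fin_bigcap_measurable => // i _; exact: measurable_nat_fibre.
  apply: eq_integral => w _; congr EFin; rewrite indicE.
  have [Aw|] := pselect (forall i, A i (X i w)).
    rewrite mem_set; last by move=> i _; exact: Aw.
    by rewrite big1 // => i _; rewrite gE indicE mem_set.
  move=> /existsNP[i Aiw].
  rewrite memNset; last first.
    by move=> /(_ i) Ai; apply/Aiw/Ai; rewrite /= finset.in_setT.
  by rewrite (bigD1 i) //= gE indicE memNset // mul0r.
pose Y w := \prod_(j | j != i) g j (X j w).
have Y0 w : 0 <= Y w by apply: prodr_ge0.
have mY : measurable_fun setT Y by exact: measurable_prod_comp.
pose EY := (\prod_(j | j != i) \int[Pr]_w (g j (X j w))%:E)%E.
have EYfin : EY \is a fin_num.
  apply: prode_fin_num => j _; apply: integrable_fin_num => //; exact: ig.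
have fibre n : (\int[Pr]_w (\1_[set n] (X i w) * Y w)%:E
    = EY * \int[Pr]_w (\1_[set n] (X i w) * 1)%:E)%E.
  pose gn j := if j == i then \1_[set n] else g j.
  have gnE j : j != i -> gn j = g j by rewrite /gn => /negbTE ->.
  have gni : gn i = \1_[set n] by rewrite /gn eqxx.
  have gnA j : j \notin s -> exists A : set nat, gn j = \1_A.
    move=> js; have [->|ji] := eqVneq j i; first by exists [set n]%classic.
    by rewrite gnE //; apply: gA; rewrite inE negb_or ji.
  have gn0 j k : 0 <= gn j k by rewrite /gn; case: eqP.
  have ign : integrable_comp gn.
    move=> j; have [->|/gnE ->] := eqVneq j i; last exact: ig.
    rewrite gni; apply: (integrable_indic Pr); exact: measurable_nat_fibre.
  have := IHs gn gn0 ign gnA.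
  rewrite (bigD1 i) //= gni.
  under eq_integral => w _.
    rewrite (bigD1 i) //= gni.
    under eq_bigr => j ji do rewrite gnE //.
    over.
  rewrite -/(Y _) => ->; rewrite muleC; congr (_ * _)%E.
    by apply: eq_bigr => j ji; rewrite gnE.
  by under [RHS]eq_integral do rewrite mulr1.
under eq_integral do rewrite (bigD1 i) //= -/(Y _).
rewrite ge0_integral_fibres // (bigD1 i) //= -/EY muleC.
under [X in (_ * X)%E]eq_integral do rewrite -[g i _]mulr1.
rewrite ge0_integral_fibres //.
rewrite -(fineK EYfin) -nneseriesZl; last first.
  by move=> n _; rewrite mule_ge0 ?lee_fin // integral_ge0.
by apply: eq_eseriesr => n _; rewrite fibre muleCA fineK.
Qed.

(** The absolute value of the product falls under the non-negative case. *)
Lemma integrable_expectation_prod g : integrable_comp g ->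
  Pr.-integrable setT (EFin \o (fun w => \prod_i g i (X i w))).
Proof.
move=> ig; apply/integrableP; split.
  exact/measurable_EFinP/measurable_prod_comp.
have iabs : integrable_comp (fun i n => `|g i n|).
  by move=> i; have /integrable_abse := ig i.
under eq_integral do rewrite /= normr_prod.
rewrite (ge0_expectation_prod _ iabs) // ltey_eq; apply/orP; left.
by apply: prode_fin_num => i _; apply: integrable_fin_num => //; exact: iabs.
Qed.

(** Both sides are linear in each [g i], and [g i] is the difference of the
    non-negative functions [`|g i| + g i] and [`|g i|]. *)
Lemma expectation_prod g : integrable_comp g ->
  (\int[Pr]_w (\prod_i g i (X i w))%:E
    = \prod_i \int[Pr]_w (g i (X i w))%:E)%E.
Proof.
(* The list s holds the indices at which g may take negative values. *)
suff ind (s : seq I) : forall g, integrable_comp g ->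
    (forall i n, i \notin s -> 0 <= g i n) ->
    (\int[Pr]_w (\prod_i g i (X i w))%:E
      = \prod_i \int[Pr]_w (g i (X i w))%:E)%E.
  by move=> ig; apply: (ind (enum I)) => // i n; rewrite mem_enum.
elim: s => [{}g ig g0|i s IHs {}g ig g0].
  by apply: ge0_expectation_prod => // i n; exact: g0.
pose upd (h : nat -> R) j := if j == i then h else g j.
have updE h j : j != i -> upd h j = g j by rewrite /upd => /negbTE ->.
have updi h : upd h i = h by rewrite /upd eqxx.
pose a n := `|g i n| + g i n; pose b n := `|g i n|.
have b0 n : 0 <= b n by exact: normr_ge0.
have a0 n : 0 <= a n by exact: normrD_ge0.
have iupd h : Pr.-integrable setT (EFin \o (fun w => h (X i w))) ->
    integrable_comp (upd h).
  move=> ih j; have [->|ji] := eqVneq j i; first by rewrite updi.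
  by rewrite updE //; exact: ig.
have ib : Pr.-integrable setT (EFin \o (fun w => b (X i w))).
  by have /integrable_abse := ig i.
have ia : Pr.-integrable setT (EFin \o (fun w => a (X i w))).
  exact: (integrableD measurableT ib (ig i)).
have prod_upd h : Pr.-integrable setT (EFin \o (fun w => h (X i w))) ->
    (forall n, 0 <= h n) ->
    (\int[Pr]_w (\prod_j upd h j (X j w))%:E
      = \int[Pr]_w (h (X i w))%:E
        * \prod_(j | j != i) \int[Pr]_w (g j (X j w))%:E)%E.
  move=> ih h0; rewrite (IHs (upd h)); first last.
  - move=> j n js; have [->|ji] := eqVneq j i; first by rewrite updi.
    by rewrite updE // g0 // inE negb_or ji.
  - exact: iupd.
  rewrite (bigD1 i) //= updi; congr (_ * _)%E.
  by apply: eq_bigr => j ji; rewrite updE.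
transitivity (\int[Pr]_w (\prod_j upd a j (X j w))%:E
    - \int[Pr]_w (\prod_j upd b j (X j w))%:E)%E.
  rewrite -integralB //; first last.
  - exact/integrable_expectation_prod/iupd.
  - exact/integrable_expectation_prod/iupd.
  apply: eq_integral => w _; rewrite -EFinB; congr EFin.
  rewrite (bigD1 i) //= [in RHS](bigD1 i) //= updi.
  rewrite [X in _ = _ - X](bigD1 i) //= updi.
  under [X in _ = _ * X - _]eq_bigr => j ji do rewrite updE //.
  under [X in _ = _ - _ * X]eq_bigr => j ji do rewrite updE //.
  by rewrite -mulrBl /a /b addrAC subrr add0r.
rewrite !prod_upd //.
rewrite -muleBl; first last.
- by rewrite fin_num_adde_defl // fin_numN integrable_fin_num.
- apply: prode_fin_num => j _; apply: integrable_fin_num => //; exact: ig.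
rewrite [RHS](bigD1 i) //=; congr (_ * _)%E.
rewrite -integralB //; apply: eq_integral => w _.
by rewrite -EFinB /a /b addrAC subrr add0r.
Qed.

End Independence.

(** At [lambda = 0] the law is the point mass at 0, and the formula persists
    because [0 ^+ 0 = 1]. *)
Lemma poisson_fibre X (lambda : R) n : 0 <= lambda ->
    distribution Pr X = poisson_prob lambda 0%N :> (set nat -> \bar R) ->
  Pr (X @^-1` [set n])%classic
    = (exp_coeff lambda n * expR (- lambda))%:E.
Proof.
move=> l0 /(congr1 (fun m => m [set n]%classic)).
rewrite /distribution /pushforward => ->.
rewrite /poisson_prob; case: ltP => [lgt0|lle0].
  rewrite esum_set1 ?lee_fin ?poisson_pmf_ge0 //.
  by rewrite /poisson_pmf lgt0 /exp_coeff.
have -> : lambda = 0 by apply: le_anti; rewrite l0 lle0.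
rewrite diracE oppr0 expR0 mulr1 /exp_coeff /= expr0n.
case: n => [|n]; first by rewrite mem_set // fact0 divr1.
by rewrite memNset // mul0r.
Qed.

Lemma ge0_expectation_poisson X (lambda : R) h (l : R) : 0 <= lambda ->
    distribution Pr X = poisson_prob lambda 0%N :> (set nat -> \bar R) ->
    (forall n, 0 <= h n) ->
    (series (fun n => h n * exp_coeff lambda n) @ \oo --> l)%classic ->
  (\int[Pr]_w (h (X w))%:E)%E = (expR (- lambda) * l)%:E.
Proof.
move=> l0 XP h0 hl.
under eq_integral do rewrite -[h _]mulr1.
rewrite ge0_integral_fibres //.
under eq_eseriesr => n _.
  under eq_integral do rewrite mulr1.
  have -> : (\int[Pr]_w (\1_[set n] (X w))%:E
      = (exp_coeff lambda n * expR (- lambda))%:E)%E.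
    rewrite -(poisson_fibre _ l0 XP) -[X in Pr X]setIT -integral_indic //.
    exact: measurable_nat_fibre.
  rewrite -EFinM mulrA mulrC EFinM; over.
rewrite nneseriesZl; last first.
  by move=> n _; rewrite lee_fin mulr_ge0 // exp_coeff_ge0.
rewrite EFinM; congr (_ * _)%E.
rewrite (_ : (fun n => _) = EFin \o series (fun n => h n * exp_coeff lambda n)).
  by rewrite EFin_lim; [congr EFin; exact/cvg_lim|apply/cvg_ex; exists l].
by apply/funext => n; rewrite /series /= sumEFin.
Qed.

Lemma cvg_series_exp_coeff (x : R) :
  (series (exp_coeff x) @ \oo --> expR x)%classic.
Proof. exact: is_cvg_series_exp_coeff. Qed.

(** The probability generating function of the Poisson law.  For negative [c]
    the power [c ^ n] is written, as in [expectation_prod], as the difference of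
    [`|c| ^ n + c ^ n] and [`|c| ^ n], for which the series have non-negative
    terms. *)
Lemma expectation_exp_poisson X (lambda c : R) : 0 <= lambda ->
    distribution Pr X = poisson_prob lambda 0%N :> (set nat -> \bar R) ->
  Pr.-integrable setT (EFin \o (fun w => c ^+ X w)) /\
  (\int[Pr]_w (c ^+ X w)%:E)%E = (expR (lambda * (c - 1)))%:E.
Proof.
move=> l0 XP.
have cE (b : R) n : b ^+ n * exp_coeff lambda n = exp_coeff (b * lambda) n.
  by rewrite /exp_coeff /= exprMn mulrA.
pose b n := `|c| ^+ n; pose a n := `|c| ^+ n + c ^+ n.
have b0 n : 0 <= b n by rewrite exprn_ge0.
have a0 n : 0 <= a n.
  by rewrite /a -normrX normrD_ge0.
have Eb : (\int[Pr]_w (b (X w))%:E)%E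
    = (expR (- lambda) * expR (`|c| * lambda))%:E.
  apply: ge0_expectation_poisson => //.
  rewrite /b; under eq_fun do rewrite cE; exact: cvg_series_exp_coeff.
have Ea : (\int[Pr]_w (a (X w))%:E)%E
    = (expR (- lambda) * (expR (`|c| * lambda) + expR (c * lambda)))%:E.
  apply: ge0_expectation_poisson => //.
  rewrite /a; under eq_fun do rewrite mulrDl !cE.
  rewrite seriesD; apply: cvgD; exact: cvg_series_exp_coeff.
have integrable_nneg h : (forall n, 0 <= h n) ->
    (\int[Pr]_w (h (X w))%:E < +oo)%E ->
    Pr.-integrable setT (EFin \o (fun w => h (X w))).
  move=> h0 hoo; apply/integrableP; split.
    exact/measurable_EFinP/measurable_comp_nat.
  by under eq_integral do rewrite gee0_abs ?lee_fin //.
have ia := integrable_nneg _ a0 (eq_ind_r (fun x => (x < +oo)%E) (ltry _) Ea).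
have ib := integrable_nneg _ b0 (eq_ind_r (fun x => (x < +oo)%E) (ltry _) Eb).
have cab w : (c ^+ X w)%:E = ((a (X w))%:E - (b (X w))%:E)%E.
  by rewrite -EFinB /a /b addrAC subrr add0r.
split.
  rewrite (_ : EFin \o _ = (fun w => (a (X w))%:E - (b (X w))%:E)%E).
    exact: (integrableB measurableT ia ib).
  exact/funext.
under eq_integral do rewrite cab.
rewrite integralB // Ea Eb -EFinB -mulrBr addrAC subrr add0r -expRD.
by congr (expR _)%:E; rewrite mulrBr mulr1 addrC mulrC.
Qed.

End NatRandomVariables.

(** * The Potts measure and the Poisson graph *)

Lemma potts_Z_gt0 (R : realType) (V : finType) (G : mgraph V) (q : nat)
    (K : edge G -> R) : (0 < q)%N -> 0 < potts_Z q K.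
Proof.
move=> q0.
rewrite /potts_Z (bigD1 [ffun=> Ordinal q0]) //= ltr_pwDl ?expR_gt0 //.
by apply: sumr_ge0 => s _; exact: expR_ge0.
Qed.

Lemma potts_sigmaE (R : realType) (V : finType) (G : mgraph V) (q : nat)
    (K : edge G -> R) (x y : V) : (0 < q)%N ->
  potts_sigma q K x y
    = (\sum_(s : {ffun V -> 'I_q})
         (q%:R * (s x == s y)%:R - 1) * potts_weight K s) / potts_Z q K.
Proof.
move=> q0.
under eq_bigr do rewrite mulrBl mul1r -mulrA.
rewrite sumrB -mulr_sumr.
under [X in _ * X - _]eq_bigr do rewrite mulr_natl mulrb.
rewrite -big_mkcond /= mulrBl divff ?gt_eqF ?potts_Z_gt0 //.
rewrite /potts_sigma /two_point mulrBr divff ?pnatr_eq0 ?gtn_eqF //.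
by rewrite /potts -mulr_suml mulrA.
Qed.

(** Taking expectations replaces [t_e(s) ^ P(e)] by
    [exp (lambda_e * (t_e(s) - 1))]: random edge multiplicities turn into Potts
    weights.  The coefficients [c s] allow for an added edge, whose factor
    depends on the spins only. *)
Lemma expectation_spin_sum (R : realType) (V : finType) (G : mgraph V)
    (q : nat) (lambda : edge G -> R) d (Omega : measurableType d)
    (Pr : probability Omega R) (P : edge G -> {RV Pr >-> nat})
    (c : {ffun V -> 'I_q} -> R) :
  (forall e, 0 <= lambda e) ->
  (forall e, distribution Pr (P e) = poisson_prob (lambda e) 0%N
             :> (set nat -> \bar R)) ->
  mutually_independent P ->
  let S := fun w => \sum_(s : {ffun V -> 'I_q}) c s
    * \prod_(e : edge G)
        (q%:R * (s (ends e).1 == s (ends e).2)%:R - 1) ^+ P e w in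
  Pr.-integrable setT (EFin \o S) /\
  (\int[Pr]_w (S w)%:E)%E
    = (expR (- \sum_e lambda e)
       * \sum_(s : {ffun V -> 'I_q}) c s * potts_weight lambda s)%:E.
Proof.
move=> l0 PE indepP S.
pose t (s : {ffun V -> 'I_q}) (e : edge G) : R :=
  q%:R * (s (ends e).1 == s (ends e).2)%:R - 1.
pose g (s : {ffun V -> 'I_q}) e n := t s e ^+ n.
have ig s e : Pr.-integrable setT (EFin \o (fun w => g s e (P e w))).
  by have [] := expectation_exp_poisson (t s e) (l0 e) (PE e).
have ip s : Pr.-integrable setT
    (fun w => (c s)%:E * (\prod_e g s e (P e w))%:E)%E.
  exact/integrableZl/(integrable_expectation_prod indepP (ig s)).
have SE w : (S w)%:E
    = (\sum_(s : {ffun V -> 'I_q}) (c s)%:E * (\prod_e g s e (P e w))%:E)%E.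
  by rewrite -sumEFin.
split.
  rewrite (_ : EFin \o S = (fun w => \sum_(s : {ffun V -> 'I_q})
      (c s)%:E * (\prod_e g s e (P e w))%:E)%E); last exact/funext.
  exact: integrable_sum.
under eq_integral do rewrite SE.
rewrite integral_sum // mulr_sumr -sumEFin; apply: eq_bigr => s _.
rewrite integralZl //; last exact: integrable_expectation_prod.
rewrite (expectation_prod indepP (ig s)).
under eq_bigr => e _.
  rewrite (expectation_exp_poisson (t s e) (l0 e) (PE e)).2; over.
rewrite prodEFin -EFinM mulrCA; congr (_ * _)%:E.
rewrite /potts_weight -expRD -expR_sum; congr expR.
by rewrite -sumrN -big_split; apply: eq_bigr => e _; rewrite mulrBr mulr1 addrC.
Qed.

Theorem theorem4p2 (R : realType) (V : finType) (G : mgraph V) (q : nat)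
    (beta : R) (J : edge G -> R)
    (d : measure_display) (Omega : measurableType d) (Pr : probability Omega R)
    (P : edge G -> {RV Pr >-> nat}) (x y : V) :
  let lambda := fun e => beta * J e in
  let GP := fun w => multiply_edges (fun e => P e w) in
  let C := fun w => (nflows (GP w) q)%:R : R in
  let Cxy := fun w => (nflows (add_edge (GP w) x y) q)%:R : R in
  loopless G ->
  (2 <= q)%N ->
  0 < beta ->
  (forall e, 0 <= J e) ->
  (* the second argument of [poisson_prob] is a dummy *)
  (forall e, distribution Pr (P e) = poisson_prob (lambda e) 0%N
             :> (set nat -> \bar R)) ->
  mutually_independent P ->
  x != y ->
  [/\ Pr.-integrable setT (EFin \o Cxy),
      Pr.-integrable setT (EFin \o C),
      fine 'E_Pr[C] != 0 &
      potts_sigma q lambda x y = fine 'E_Pr[Cxy] / fine 'E_Pr[C]].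
Proof.
move=> lambda GP C Cxy _ q2 beta0 J0 PE indepP _.
have q0 : (0 < q)%N by exact: ltn_trans q2.
have l0 e : 0 <= lambda e by rewrite mulr_ge0 // ltW.
have Z0 := potts_Z_gt0 lambda q0.
pose qV : R := q%:R ^+ #|V|.
have qV0 : 0 < qV by rewrite exprn_gt0 // ltr0n.
pose spin_sum (c : {ffun V -> 'I_q} -> R) w := \sum_(s : {ffun V -> 'I_q}) c s
    * \prod_(e : edge G)
        (q%:R * (s (ends e).1 == s (ends e).2)%:R - 1) ^+ P e w.
pose cxy (s : {ffun V -> 'I_q}) : R := q%:R * (s x == s y)%:R - 1.
pose t (s : {ffun V -> 'I_q}) (p : V * V) : R := q%:R * (s p.1 == s p.2)%:R - 1.
have CE w : C w = qV^-1 * spin_sum (fun=> 1) w.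
  apply: (mulIf (lt0r_neq0 qV0)).
  rewrite nflows_potts_sum // mulrAC mulVf ?gt_eqF // mul1r.
  apply: eq_bigr => s _.
  by rewrite mul1r -(prod_multiply_edges (fun e => P e w) (t s)).
have CxyE w : Cxy w = qV^-1 * spin_sum cxy w.
  apply: (mulIf (lt0r_neq0 qV0)).
  rewrite nflows_potts_sum // mulrAC mulVf ?gt_eqF // mul1r.
  apply: eq_bigr => s _.
  by rewrite (prod_add_edge (GP w) x y (t s)) prod_multiply_edges.
pose a : R := qV^-1 * expR (- \sum_e lambda e).
have a0 : 0 < a by rewrite mulr_gt0 ?invr_gt0 ?expR_gt0.
have expectation_scaled (F : Omega -> R) (c : {ffun V -> 'I_q} -> R) :
    (forall w, F w = qV^-1 * spin_sum c w) ->
  Pr.-integrable setT (EFin \o F) /\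
  fine 'E_Pr[F]%E = a * \sum_s c s * potts_weight lambda s.
  move=> FE; have [iS ES] := expectation_spin_sum c l0 PE indepP.
  have -> : F = fun w => qV^-1 * spin_sum c w by exact/funext.
  split; first exact: (integrableZl measurableT _ iS).
  rewrite unlock; under eq_integral do rewrite EFinM.
  by rewrite integralZl // ES -EFinM mulrA.
have [iC EC] := expectation_scaled _ _ CE.
have [iCxy ECxy] := expectation_scaled _ _ CxyE.
have ECZ : fine 'E_Pr[C] = a * potts_Z q lambda.
  by rewrite EC; congr (_ * _); apply: eq_bigr => s _; rewrite mul1r.
split=> //; first by rewrite ECZ mulf_neq0 ?gt_eqF.
by rewrite potts_sigmaE // ECZ ECxy -mulf_div divff ?gt_eqF // mul1r.
Qed.
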